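(* Suppose $G(\mathbf p)$ is a planar framework such that the line arrangement $\mathcal A_{G(\mathbf p)}$ has the generic matroid $\mathcal M(G)$ associated to $G$ (and no two lines of $\mathcal A_{G(\mathbf p)}$ meet on the line at infinity). Then the space of infinitesimal motions of $G(\mathbf p)$ and the space of line arrangements which are weak perspective representations of $\mathcal A_{G(\mathbf p)}$ from the line at infinity are isomorphic. In particular, $\mathcal A_{G(\mathbf p)}$ is formal if and only if $G(\mathbf p)$ is infinitesimally rigid.
   Context: The ground field is $\mathbb R$, and $\mathbb R^2\subset\mathbb P^2$ via $(x,y)\mapsto[x:y:1]$, with line at infinity $H_0=\mathbb V(\alpha_0)$, $\alpha_0=z$. Frameworks: for a graph $G=(U,E)$, a framework $G(\mathbf p)$ is $G$ together with a placement $\mathbf p:U\to\mathbb R^2$. An infinitesimal motion is an assignment of vectors $\mathbf v_i\in\mathbb R^2$ to the vertices with $(\mathbf p_i-\mathbf p_j)\cdot(\mathbf v_i-\mathbf v_j)=0$ for every edge $ij$; equivalently, an element of the kernel of the rigidity matrix of $G(\mathbf p)$, which has one row for each edge and two columns for each vertex. $G(\mathbf p)$ is infinitesimally rigid if its only infinitesimal motions are the trivial ones, induced by infinitesimal isometries of the plane (the rigidity matrix has rank $2|U|-3$). Line arrangement: let $E=\{e_1,\dots,e_n\}$ and let $G(\mathbf p)$ be a framework in which all edges define distinct lines. Let $\alpha_i$ be a linear form on $\mathbb R^3$ defining the (projective closure of the) line along the edge $e_i$; $\mathcal A_{G(\mathbf p)}=\mathcal A(\alpha)$ is the resulting arrangement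 of $n$ lines in $\mathbb P^2$, and $\mathcal M(\alpha)$ is the linear matroid of $\alpha_1,\dots,\alpha_n$ on $\{1,\dots,n\}$. The generic matroid $\mathcal M(G)$ is $\mathcal M(\alpha)$ for a generic placement $\mathbf p$. Formality: $\mathcal A(\alpha)$ is formal if the space of linear relations $\{c\in\mathbb R^n:\sum c_i\alpha_i=0\}$ is generated by relations with exactly three nonzero entries. Weak perspective representations: two line arrangements $\mathcal A(\alpha)$, $\mathcal A'(\beta)$ not containing $H_0$ are perspective from $H_0$ if corresponding lines meet $H_0$ in the same point; after rescaling the forms, this means $\beta_j=\alpha_j+\lambda_j\alpha_0$ with $\lambda_j\in\mathbb R$. For a matroid $\mathcal N$, $\mathcal N^{[k]}$ is the truncation whose independent sets are the independent sets of $\mathcal N$ of size at most $k$. The weak perspective representations of $\mathcal A(\alpha)$ from the line at infinity are the maps $\beta$, $\beta_j=\alpha_j+\lambda_j\alpha_0$, such that, with $k=\operatorname{rank}\mathcal M(\alpha)$, every dependent set of $\mathcal M(\alpha)^{[k]}=\mathcal M(\alpha)$ is dependent in $\mathcal M(\beta)^{[k]}$. The space of them is identified with the set of the corresponding vectors $\lambda\in\mathbb R^n$.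
   Formalization: Every vertex of G is assumed to lie on at least two edges; without this the claim fails (a single edge has a 3-dimensional space of infinitesimal motions but only a 1-dimensional space of weak perspective representations). *)

(* Defs.v *)
From HB Require Import structures.
From mathcomp Require Import all_boot all_order all_algebra.
From mathcomp Require Import mpoly reals.

Set Implicit Arguments.
Unset Strict Implicit.
Unset Printing Implicit Defensive.

Import Order.TTheory GRing.Theory Num.Theory.
Local Open Scope ring_scope.

Definition dot (R : realType) (m : nat) (x y : 'rV[R]_m) : R :=
  \sum_(k < m) x 0 k * y 0 k.

(* The finite simple graph with vertex set [U] and edges e_0, ..., e_(n-1),
   each edge being a set of two vertices. *)
Definition simple_graph (U : finType) (n : nat) (e : 'I_n -> {set U}) : Prop :=
  injective e /\ forall i, #|e i| = 2%N.

(* Bounding the degree below by 2 makes every vertex an intersection point of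
   the arrangement. A vertex on at most one line can move along that line
   without changing the arrangement, so the lines do not see all motions. *)
Definition degree (U : finType) (n : nat) (e : 'I_n -> {set U}) (u : U) : nat :=
  #|[set i | u \in e i]|.

(* The condition is void for a = b, so this is the usual condition on edges. *)
Definition infinitesimal_motion (R : realType) (U : finType) (n : nat)
    (e : 'I_n -> {set U}) (p : U -> 'rV[R]_2)
    (v : {ffun U -> 'rV[R]_2}) : Prop :=
  forall (i : 'I_n) (a b : U), a \in e i -> b \in e i ->
    dot (p a - p b) (v a - v b) = 0.

(* Infinitesimal isometries of the plane are the vector fields
   x |-> x A + t with A skew-symmetric. *)
Definition trivial_motion (R : realType) (U : finType)
    (p : U -> 'rV[R]_2) (v : {ffun U -> 'rV[R]_2}) : Prop :=
  exists (A : 'M[R]_2) (t : 'rV[R]_2),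
    A^T = - A /\ forall a, v a = p a *m A + t.

Definition infinitesimally_rigid (R : realType) (U : finType) (n : nat)
    (e : 'I_n -> {set U}) (p : U -> 'rV[R]_2) : Prop :=
  forall v, infinitesimal_motion e p v -> trivial_motion p v.

(* A linear form on R^3 is given by its row of coefficients and evaluated by
   [dot]; [affine_pt x] is the representative (x, y, 1) of a point of the plane. *)
Definition affine_pt (R : realType) (x : 'rV[R]_2) : 'rV[R]_3 :=
  row_mx x (const_mx 1 : 'rV[R]_1).

(* The form z, defining the line at infinity. *)
Definition alpha0 (R : realType) : 'rV[R]_3 := delta_mx 0 ord_max.

(* The endpoints of each edge are distinct points, and [alpha i] defines the
   projective closure of the line through them. *)
Definition edge_forms (R : realType) (U : finType) (n : nat)
    (e : 'I_n -> {set U}) (p : U -> 'rV[R]_2)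
    (alpha : 'I_n -> 'rV[R]_3) : Prop :=
  forall i : 'I_n,
    [/\ {in e i &, injective p},
        alpha i != 0
      & forall a, a \in e i -> dot (alpha i) (affine_pt (p a)) = 0].

Definition distinct_lines (R : realType) (n : nat)
    (alpha : 'I_n -> 'rV[R]_3) : Prop :=
  forall i j : 'I_n, i != j ->
    ~ (forall x : 'rV[R]_3, dot (alpha i) x = 0 <-> dot (alpha j) x = 0).

Definition no_meet_at_infinity (R : realType) (n : nat)
    (alpha : 'I_n -> 'rV[R]_3) : Prop :=
  forall i j : 'I_n, i != j ->
    ~ (exists x : 'rV[R]_3,
         [/\ x != 0, dot (alpha0 R) x = 0,
             dot (alpha i) x = 0 & dot (alpha j) x = 0]).

Definition linear_matroid (R : realType) (n : nat)
    (alpha : 'I_n -> 'rV[R]_3) : {set {set 'I_n}} :=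
  [set S : {set 'I_n} | free [seq alpha i | i in S]].

Definition matroid_rank (n : nat) (N : {set {set 'I_n}}) : nat :=
  \max_(S in N) #|S|.

Definition truncation (n : nat) (k : nat) (N : {set {set 'I_n}}) :
    {set {set 'I_n}} :=
  [set S in N | (#|S| <= k)%N].

(* The 2|U| coordinates of the placement are algebraically independent
   over the rationals. *)
Definition generic_placement (R : realType) (U : finType)
    (q : U -> 'rV[R]_2) : Prop :=
  forall P : {mpoly rat[#|{: U * 'I_2}|]}, P != 0 ->
    (map_mpoly ratr P).@[fun k => q (enum_val k).1 0 (enum_val k).2] != 0.

(* All generic placements give the same matroid, so that [N] is determined
   by the graph. *)
Definition is_generic_matroid (R : realType) (U : finType) (n : nat)
    (e : 'I_n -> {set U}) (N : {set {set 'I_n}}) : Prop :=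
  exists (q : U -> 'rV[R]_2) (gamma : 'I_n -> 'rV[R]_3),
    [/\ generic_placement q, edge_forms e q gamma & N = linear_matroid gamma].

Definition linear_relation (R : realType) (n : nat)
    (alpha : 'I_n -> 'rV[R]_3) (c : 'rV[R]_n) : Prop :=
  \sum_(i < n) c 0 i *: alpha i = 0.

Definition formal (R : realType) (n : nat)
    (alpha : 'I_n -> 'rV[R]_3) : Prop :=
  forall c : 'rV[R]_n, linear_relation alpha c ->
    exists s : seq 'rV[R]_n,
      (forall d, d \in s ->
         linear_relation alpha d /\ #|[set i | d 0 i != 0]| = 3%N)
      /\ c \in <<s>>%VS.

Definition perspective (R : realType) (n : nat)
    (alpha : 'I_n -> 'rV[R]_3) (lambda : 'rV[R]_n) : 'I_n -> 'rV[R]_3 :=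
  fun j => alpha j + lambda 0 j *: alpha0 R.

Definition weak_perspective (R : realType) (n : nat)
    (alpha : 'I_n -> 'rV[R]_3) (lambda : 'rV[R]_n) : Prop :=
  let k := matroid_rank (linear_matroid alpha) in
  forall S : {set 'I_n},
    S \notin truncation k (linear_matroid alpha) ->
    S \notin truncation k (linear_matroid (perspective alpha lambda)).

(* Both predicates define linear subspaces, and these are isomorphic. *)
Definition isomorphic_spaces (R : realType) (V W : vectType R)
    (P : V -> Prop) (Q : W -> Prop) : Prop :=
  exists (A : {vspace V}) (B : {vspace W}),
    [/\ forall v, v \in A <-> P v,
        forall w, w \in B <-> Q w
      & exists f : {linear subvs_of A -> subvs_of B}, bijective f].

(* Main.v *)
(* Rotate a velocity field v on the vertices by a quarter turn. It is an
   infinitesimal motion exactly when, for every edge i, the two endpoints assign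
   to the line i the same shift lambda_i, the component of the rotated velocity
   along the normal of the line. Since every vertex lies on two lines which are
   not parallel, v is recovered from lambda, and the vectors lambda obtained in
   this way are those for which the shifted lines through each vertex remain
   concurrent. For a generic matroid the dependent triples are exactly the
   triples of edges with a common vertex, so this says that the arrangement
   alpha + lambda alpha_0 is a weak perspective representation.

   The same concurrency conditions say that lambda is orthogonal to the relations
   of alpha with three nonzero entries, whereas the trivial motions give the
   vectors (alpha_i(x))_i, which form the orthogonal complement of all relations.
   Hence rigidity and formality both say that these complements agree. *)

Require Import Defs.
From HB Require Import structures.
From mathcomp Require Import all_boot all_order all_algebra.
From mathcomp Require Import mpoly reals ring lra.

Set Implicit Arguments.
Unset Strict Implicit.
Unset Printing Implicit Defensive.

Import Order.TTheory GRing.Theory Num.Theory.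
Local Open Scope ring_scope.

(** * Joins of points and their determinant at a generic placement *)

Definition join_line (S : comNzRingType) (x y : S * S) : S * S * S :=
  (x.2 - y.2, y.1 - x.1, x.1 * y.2 - x.2 * y.1).

Definition det3 (S : comNzRingType) (u v w : S * S * S) : S :=
  u.1.1 * (v.1.2 * w.2 - v.2 * w.1.2)
  - u.1.2 * (v.1.1 * w.2 - v.2 * w.1.1)
  + u.2 * (v.1.1 * w.1.2 - v.1.2 * w.1.1).

(** The rows are the cross products of (x, 1) and (y, 1), that is, the coefficients of the lines
    through the two points. The ring is arbitrary so that one formula serves polynomials, rationals
    and reals. *)
Definition joins_det (S : comNzRingType) (a b c d f g : S * S) : S :=
  det3 (join_line a b) (join_line c d) (join_line f g).

Definition map_pair (S T : Type) (h : S -> T) (x : S * S) : T * T :=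
  (h x.1, h x.2).

Lemma rmorph_joins_det (S T : comNzRingType) (h : {rmorphism S -> T})
    (a b c d f g : S * S) :
  h (joins_det a b c d f g) =
  joins_det (map_pair h a) (map_pair h b) (map_pair h c)
            (map_pair h d) (map_pair h f) (map_pair h g).
Proof. by rewrite /joins_det /det3 /= !(rmorphB, rmorphD, rmorphM). Qed.

Definition coords (S : Type) (x : 'rV[S]_2) : S * S := (x 0 0, x 0 1).

(** The determinant is a rational polynomial in the coordinates, so by genericity a single rational
    placement where it does not vanish is enough. The case a = c is allowed. *)
Lemma generic_joins_det (R : realType) (U : finType) (q : U -> 'rV[R]_2)
    (a b c d f g : U) :
  generic_placement q ->
  b \notin [:: a; c] -> d \notin [:: a; c] ->
  f \notin [:: a; c] -> g \notin [:: a; c] -> b != d -> f != g ->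
  joins_det (coords (q a)) (coords (q b)) (coords (q c))
            (coords (q d)) (coords (q f)) (coords (q g)) != 0.
Proof.
move=> genq hb hd hf hg bd fg.
pose X (u : U) : {mpoly rat[#|{: U * 'I_2}|]} * {mpoly rat[#|{: U * 'I_2}|]} :=
  ('X_(enum_rank (u, 0 : 'I_2)), 'X_(enum_rank (u, 1 : 'I_2))).
have := genq (joins_det (X a) (X b) (X c) (X d) (X f) (X g)).
rewrite !rmorph_joins_det.
have E u : map_pair (meval (fun k => q (enum_val k).1 0 (enum_val k).2))
    (map_pair (map_mpoly ratr) (X u)) = coords (q u).
  by rewrite /map_pair /coords /= !map_mpolyX !mevalXU !enum_rankK.
rewrite !E; apply.
(* The witness puts a and c at the origin and all other vertices at distinct
   points of the line x + y = 1. *)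
pose r (u : U) : rat := (enum_rank u)%:R.
pose x (u : U) : rat * rat := if u \in [:: a; c] then (0, 0) else (r u, 1 - r u).
pose w (k : 'I_#|{: U * 'I_2}|) : rat :=
  if (enum_val k).2 == 0 then (x (enum_val k).1).1 else (x (enum_val k).1).2.
have Ew u : map_pair (meval w) (X u) = x u.
  by rewrite /map_pair /= !mevalXU /w !enum_rankK /=; case: (x u).
apply/eqP => /(congr1 (meval w)); rewrite rmorph_joins_det !Ew rmorph0.
rewrite /x (negbTE hb) (negbTE hd) (negbTE hf) (negbTE hg).
rewrite !inE !eqxx orbT /= /joins_det /det3 /= => /eqP.
(* Two of the lines pass through the origin and the third is x + y = 1, so the determinant factors
   into differences of abscissas. *)
have -> : forall xb xd xf xg : rat,
  (0 - (1 - xb)) * ((xd - 0) * (xf * (1 - xg) - (1 - xf) * xg)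
    - (0 * (1 - xd) - 0 * xd) * (xg - xf))
  - (xb - 0) * ((0 - (1 - xd)) * (xf * (1 - xg) - (1 - xf) * xg)
    - (0 * (1 - xd) - 0 * xd) * (1 - xf - (1 - xg)))
  + (0 * (1 - xb) - 0 * xb) * ((0 - (1 - xd)) * (xg - xf)
    - (xd - 0) * (1 - xf - (1 - xg))) = (xb - xd) * (xf - xg).
  by move=> *; ring.
have inj u v : u != v -> r u - r v != 0.
  move=> uv; rewrite subr_eq0 eqr_nat; apply: contra uv => /eqP uv.
  by apply/eqP/enum_rank_inj/val_inj.
by rewrite mulf_eq0 (negbTE (inj _ _ bd)) (negbTE (inj _ _ fg)).
Qed.

(** * Coordinates of linear forms and of points *)

Lemma sum_ord2 (V : nmodType) (F : 'I_2 -> V) : \sum_k F k = F 0 + F 1.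
Proof.
by rewrite !big_ord_recl big_ord0 addr0; congr (_ + F _); apply: val_inj.
Qed.

Lemma sum_ord3 (V : nmodType) (F : 'I_3 -> V) :
  \sum_k F k = F 0 + F 1 + F ord_max.
Proof.
by rewrite !big_ord_recl big_ord0 addr0 addrA; congr (_ + F _ + F _);
  apply: val_inj.
Qed.

Lemma dot_affine (R : realType) (l : 'rV[R]_3) (x : 'rV[R]_2) :
  dot l (affine_pt x) = l 0 0 * x 0 0 + l 0 1 * x 0 1 + l 0 ord_max.
Proof.
have E (k : 'I_3) (z : 'I_2 + 'I_1) : k = @unsplit 2 1 z ->
    affine_pt x 0 k = match z with inl i => x 0 i | inr _ => 1 end.
  move=> ->; rewrite /affine_pt; case: z => i /=.
    by rewrite (@row_mxEl _ _ 2 1).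
  by rewrite (@row_mxEr _ _ 2 1) mxE.
rewrite /dot sum_ord3 (E 0 (inl 0)) ?(E 1 (inl 1)) ?(E ord_max (inr 0)) ?mulr1 //;
  exact: val_inj.
Qed.

Lemma form_eq0 (R : realType) (l : 'rV[R]_3) :
  l 0 0 = 0 -> l 0 1 = 0 -> l 0 ord_max = 0 -> l = 0.
Proof.
move=> l0 l1 l2; apply/rowP => k; rewrite [RHS]mxE.
by case: k => -[|[|[|//]]] h;
  [rewrite -[RHS]l0 | rewrite -[RHS]l1 | rewrite -[RHS]l2];
  congr (l _ _); apply: val_inj.
Qed.

Lemma plane_eq0 (R : realType) (x : 'rV[R]_2) : x 0 0 = 0 -> x 0 1 = 0 -> x = 0.
Proof.
move=> x0 x1; apply/rowP => k; rewrite [RHS]mxE.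
by case: k => -[|[|//]] h; [rewrite -[RHS]x0 | rewrite -[RHS]x1];
  congr (x _ _); apply: val_inj.
Qed.

Lemma form_join (R : realType) (l : 'rV[R]_3) (x y : 'rV[R]_2) :
  x != y -> l != 0 -> dot l (affine_pt x) = 0 -> dot l (affine_pt y) = 0 ->
  exists2 s : R, s != 0 &
    (l 0 0, l 0 1, l 0 ord_max) =
    (s * (join_line (coords x) (coords y)).1.1,
     s * (join_line (coords x) (coords y)).1.2,
     s * (join_line (coords x) (coords y)).2).
Proof.
rewrite !dot_affine /= => xy l0 hx hy.
set d0 := y 0 0 - x 0 0; set d1 := x 0 1 - y 0 1.
have N0 : d0 ^+ 2 + d1 ^+ 2 != 0.
  rewrite paddr_eq0 ?sqr_ge0 // !sqrf_eq0 !subr_eq0.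
  apply: contra xy => /andP[/eqP e0 /eqP e1]; rewrite -subr_eq0.
  by apply/eqP/plane_eq0; rewrite !mxE ?e0 ?e1 subrr.
(* The normal of the join is (d1, d0); [s] is the coefficient of the orthogonal projection of the
   normal of [l] onto it. *)
pose s := (l 0 0 * d1 + l 0 1 * d0) / (d0 ^+ 2 + d1 ^+ 2).
have hd : l 0 0 * d0 = l 0 1 * d1 by rewrite /d0 /d1; lra.
have Es : s * (d0 ^+ 2 + d1 ^+ 2) = l 0 0 * d1 + l 0 1 * d0 by rewrite divfK.
have E0 : l 0 0 = s * d1.
  by apply: (mulIf N0); rewrite mulrAC Es; have := congr1 ( *%R d0) hd; lra.
have E1 : l 0 1 = s * d0.
  by apply: (mulIf N0); rewrite mulrAC Es; have := congr1 ( *%R d1) hd; lra.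
have E2 : l 0 ord_max = s * (x 0 0 * y 0 1 - x 0 1 * y 0 0).
  by have: l 0 ord_max = - (s * d1 * x 0 0 + s * d0 * x 0 1);
    [rewrite -E0 -E1; lra | rewrite /d0 /d1 => ->; ring].
exists s; last by rewrite -E2 -E0 -E1.
apply: contra l0 => /eqP s0; apply/eqP/form_eq0.
- by rewrite E0 s0 mul0r.
- by rewrite E1 s0 mul0r.
- by rewrite E2 s0 mul0r.
Qed.

(** * Three edges without a common vertex are independent in the generic matroid *)

Lemma linear_matroidP (R : realType) (n : nat) (alpha : 'I_n -> 'rV[R]_3)
    (S : {set 'I_n}) :
  reflect (forall c : 'rV[R]_n, (forall i, i \notin S -> c 0 i = 0) ->
             linear_relation alpha c -> c = 0)
          (S \in linear_matroid alpha).
Proof.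
have nthE (j : 'I_#|S|) : (image_tuple alpha S)`_j = alpha (enum_val j).
  by rewrite nth_image.
rewrite inE; apply: (iffP (freeP (X := image_tuple alpha S))).
- move=> Sfree c c0 rel; apply/rowP => i; rewrite mxE.
  have [iS|/c0//] := boolP (i \in S).
  rewrite -(enum_rankK_in iS iS); apply: (Sfree (fun j => c 0 (enum_val j))).
  under eq_bigr do rewrite nthE.
  rewrite -(big_enum_val (fun i => c 0 i *: alpha i)) -[RHS]rel big_mkcond.
  by apply: eq_bigr => l _; case: ifPn => // /c0 ->; rewrite scale0r.
- move=> Sind k ksum j.
  (* Extension of [k] by zero: the inner sum has one term when i is in [S] and is empty
     otherwise. *)
  pose c : 'rV[R]_n := \row_i \sum_(l | enum_val l == i) k l.
  have ck l : c 0 (enum_val l) = k l.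
    rewrite mxE (big_pred1 l) // => m /=.
    by apply/eqP/eqP => [/enum_val_inj|->].
  rewrite -ck (Sind c) ?mxE // => [i iS|].
    by rewrite mxE big_pred0 // => l; apply: contraNF iS => /eqP <-; apply: enum_valP.
  rewrite /linear_relation -[RHS]ksum (partition_big (fun l => enum_val l) xpredT) //=.
  apply: eq_bigr => i _; rewrite mxE scaler_suml.
  by apply: eq_bigr => l /eqP <-; rewrite nthE.
Qed.

(* The position of three edges for which [generic_joins_det] applies. *)
Definition joins_position (U : finType) (A B C : {set U}) : Prop :=
  exists a b c d f g,
    [/\ [/\ A = [set a; b], B = [set c; d] & C = [set f; g]],
        [/\ b \notin [:: a; c], d \notin [:: a; c], f \notin [:: a; c]
          & g \notin [:: a; c]], b != d & f != g].

Lemma pair_other (U : finType) (A : {set U}) (a : U) :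
  #|A| = 2%N -> a \in A -> exists2 b, b != a & A = [set a; b].
Proof.
move=> A2 aA; have /cards1P[b Ab] : #|A :\ a| == 1%N.
  by rewrite -(eqn_add2l (a \in A)) -cardsD1 A2 aA.
exists b; last by rewrite -Ab setD1K.
by have := set11 b; rewrite -Ab !inE => /andP[].
Qed.

(** If two of the edges meet, a cyclic rotation puts them first, with a = c their common vertex,
    which the third edge avoids. If the edges are pairwise disjoint, any order works. *)
Lemma no_common_vertex_joins_position (U : finType) (A B C : {set U}) :
  #|A| = 2%N -> #|B| = 2%N -> #|C| = 2%N -> A != B -> B != C -> C != A ->
  (forall u, ~ [/\ u \in A, u \in B & u \in C]) ->
  [\/ joins_position A B C, joins_position B C A | joins_position C A B].
Proof.
have adj (A' B' C' : {set U}) (a : U) : #|A'| = 2%N -> #|B'| = 2%N ->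
    #|C'| = 2%N -> A' != B' -> a \in A' -> a \in B' -> a \notin C' ->
    joins_position A' B' C'.
  move=> A2 B2 C2 AB aA aB aC.
  have [b ba Ab] := pair_other A2 aA; have [d da Bd] := pair_other B2 aB.
  have /eqP/cards2P[f [g [fg Cfg]]] := C2.
  move: aC; rewrite Cfg !inE negb_or ![a == _]eq_sym => /andP[fa ga].
  exists a, b, a, d, f, g; split=> //; last first.
    by apply: contra AB => /eqP bd; rewrite Ab Bd bd.
  by rewrite !inE !orbb.
move=> A2 B2 C2 AB BC CA noU.
have [/existsP[u /andP[uA uB]]|nAB] := boolP [exists u, (u \in A) && (u \in B)].
  by constructor 1; apply: (adj _ _ _ u) => //; apply/negP => uC; apply: (noU u).
have [/existsP[u /andP[uB uC]]|nBC] := boolP [exists u, (u \in B) && (u \in C)].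
  by constructor 2; apply: (adj _ _ _ u) => //; apply/negP => uA; apply: (noU u).
have [/existsP[u /andP[uC uA]]|nCA] := boolP [exists u, (u \in C) && (u \in A)].
  by constructor 3; apply: (adj _ _ _ u) => //; apply/negP => uB; apply: (noU u).
constructor 1.
have sep (X Y : {set U}) (x y : U) : ~~ [exists u, (u \in X) && (u \in Y)] ->
    x \in X -> y \in Y -> (x == y) = false.
  rewrite negb_exists => /forallP XY xX yY.
  by apply/negP => /eqP exy; have := XY x; rewrite xX exy yY.
have /eqP/cards2P[a [b [ab EA]]] := A2; have /eqP/cards2P[c [d [cd EB]]] := B2.
have /eqP/cards2P[f [g [fg EC]]] := C2.
have [aA bA] : a \in A /\ b \in A by rewrite EA set21 set22.
have [cB dB] : c \in B /\ d \in B by rewrite EB set21 set22.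
have [fC gC] : f \in C /\ g \in C by rewrite EC set21 set22.
exists a, b, c, d, f, g; split=> //; last by rewrite (sep A B).
rewrite !inE !negb_or ![b == a]eq_sym ab ![d == _]eq_sym cd.
rewrite (sep A B b c) ?(sep A B a d) ?(sep C A f a) ?(sep C A g a) //.
by rewrite ![_ == c]eq_sym ?(sep B C c f) ?(sep B C c g).
Qed.

(** Each form is a nonzero multiple of the join of its endpoints, so the relation is one between the
    rows of a nonzero determinant. *)
Lemma joins_position_independent (R : realType) (U : finType) (n : nat)
    (e : 'I_n -> {set U}) (q : U -> 'rV[R]_2) (gamma : 'I_n -> 'rV[R]_3)
    (i j k : 'I_n) (x y z : R) :
  generic_placement q -> edge_forms e q gamma ->
  joins_position (e i) (e j) (e k) ->
  x *: gamma i + y *: gamma j + z *: gamma k = 0 -> [/\ x = 0, y = 0 & z = 0].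
Proof.
move=> genq forms [a [b [c [d [f [g [[Ei Ej Ek] [hb hd hf hg] bd fg]]]]]]] rel.
have join l u v : e l = [set u; v] -> u != v -> exists2 s : R, s != 0 &
    (gamma l 0 0, gamma l 0 1, gamma l 0 ord_max) =
    (s * (join_line (coords (q u)) (coords (q v))).1.1,
     s * (join_line (coords (q u)) (coords (q v))).1.2,
     s * (join_line (coords (q u)) (coords (q v))).2).
  move=> El uv; have [inj l0 van] := forms l.
  have [ul vl] : u \in e l /\ v \in e l by rewrite El set21 set22.
  apply: form_join => //; try exact: van.
  by apply: contra uv => /eqP /(inj _ _ ul vl) ->.
have [|s s0 [Ei0 Ei1 Ei2]] := join i a b Ei.
  by move: hb; rewrite !inE negb_or eq_sym => /andP[].
have [|t t0 [Ej0 Ej1 Ej2]] := join j c d Ej.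
  by move: hd; rewrite !inE negb_or ![d == _]eq_sym => /andP[].
have [r r0 [Ek0 Ek1 Ek2]] := join k f g Ek fg.
have D0 := generic_joins_det genq hb hd hf hg bd fg.
move: D0 Ei0 Ei1 Ei2 Ej0 Ej1 Ej2 Ek0 Ek1 Ek2.
rewrite /joins_det; set X := join_line _ _; set Y := join_line _ _.
set Z := join_line _ _ => D0 Ei0 Ei1 Ei2 Ej0 Ej1 Ej2 Ek0 Ek1 Ek2.
have coef m : x * gamma i 0 m + y * gamma j 0 m + z * gamma k 0 m = 0.
  by have := congr1 (fun l : 'rV_3 => l 0 m) rel; rewrite !mxE.
have := coef 0; have := coef 1; have := coef ord_max.
rewrite Ei0 Ei1 Ei2 Ej0 Ej1 Ej2 Ek0 Ek1 Ek2 => r2 r1 r0'.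
have cancel (w sc : R) : sc != 0 -> w * sc * det3 X Y Z = 0 -> w = 0.
  by move=> sc0 /eqP; rewrite !mulf_eq0 (negbTE D0) (negbTE sc0) !orbF => /eqP.
(* By multilinearity, replacing a row of the determinant by the vanishing
   combination multiplies it by the coefficient of that row. *)
split; [apply: (cancel _ s) | apply: (cancel _ t) | apply: (cancel _ r)] => //.
- rewrite -[RHS](_ : det3 (x * (s * X.1.1) + y * (t * Y.1.1) + z * (r * Z.1.1),
    x * (s * X.1.2) + y * (t * Y.1.2) + z * (r * Z.1.2),
    x * (s * X.2) + y * (t * Y.2) + z * (r * Z.2)) Y Z = 0) /det3 /=; last first.
    by rewrite r0' r1 r2; ring.
  by ring.
- rewrite -[RHS](_ : det3 X (x * (s * X.1.1) + y * (t * Y.1.1) + z * (r * Z.1.1),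
    x * (s * X.1.2) + y * (t * Y.1.2) + z * (r * Z.1.2),
    x * (s * X.2) + y * (t * Y.2) + z * (r * Z.2)) Z = 0) /det3 /=; last first.
    by rewrite r0' r1 r2; ring.
  by ring.
- rewrite -[RHS](_ : det3 X Y (x * (s * X.1.1) + y * (t * Y.1.1) + z * (r * Z.1.1),
    x * (s * X.1.2) + y * (t * Y.1.2) + z * (r * Z.1.2),
    x * (s * X.2) + y * (t * Y.2) + z * (r * Z.2)) = 0) /det3 /=; last first.
    by rewrite r0' r1 r2; ring.
  by ring.
Qed.

Lemma sum_support3 (V : nmodType) (n : nat) (i j k : 'I_n) (F : 'I_n -> V) :
  i != j -> j != k -> k != i -> (forall l, l \notin [set i; j; k] -> F l = 0) ->
  \sum_l F l = F i + F j + F k.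
Proof.
move=> ij jk ki F0; rewrite (bigID (mem [set i; j; k])) /=.
rewrite [X in _ + X]big1 // addr0 -setUA !big_setU1 ?big_set1 ?inE //.
  by rewrite /= addrA.
by rewrite negb_or ij eq_sym.
Qed.

Lemma generic_triple (R : realType) (U : finType) (n : nat)
    (e : 'I_n -> {set U}) (N : {set {set 'I_n}}) (i j k : 'I_n) :
  simple_graph e -> is_generic_matroid R e N -> i != j -> j != k -> k != i ->
  (forall u, ~ [/\ u \in e i, u \in e j & u \in e k]) -> [set i; j; k] \in N.
Proof.
move=> [einj e2] [q [gamma [genq forms ->]]] ij jk ki noU.
apply/linear_matroidP => c c0 rel.
have rel3 : c 0 i *: gamma i + c 0 j *: gamma j + c 0 k *: gamma k = 0.
  by rewrite -[RHS]rel (sum_support3 ij jk ki) // => l /c0 ->; rewrite scale0r.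
suff [ci cj ck] : [/\ c 0 i = 0, c 0 j = 0 & c 0 k = 0].
  apply/rowP => l; rewrite mxE; have [|/c0//] := boolP (l \in [set i; j; k]).
  by rewrite !inE => /orP[/orP[]|] /eqP ->.
have ne l m : l != m -> e l != e m by apply: contra => /eqP /einj ->.
have [P|P|P] := no_common_vertex_joins_position
  (e2 i) (e2 j) (e2 k) (ne _ _ ij) (ne _ _ jk) (ne _ _ ki) noU.
- exact: joins_position_independent forms P rel3.
- have [|-> -> ->] // := joins_position_independent genq forms P
    (x := c 0 j) (y := c 0 k) (z := c 0 i).
  by rewrite addrC addrA.
- have [|-> -> ->] // := joins_position_independent genq forms P
    (x := c 0 k) (y := c 0 i) (z := c 0 j).
  by rewrite -addrA addrC.
Qed.

(** * Spans and orthogonal complements *)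

Lemma orthogonal_span (R : fieldType) (n : nat) (s : seq 'rV[R]_n)
    (c l : 'rV[R]_n) :
  c \in <<s>>%VS -> (forall d, d \in s -> \sum_i d 0 i * l 0 i = 0) ->
  \sum_i c 0 i * l 0 i = 0.
Proof.
move=> cs orth; have cE : c = _ := coord_span (X := in_tuple s) cs.
have -> : \sum_i c 0 i * l 0 i = \sum_(k < size s)
    coord (in_tuple s) k c * \sum_i s`_k 0 i * l 0 i.
  under [RHS]eq_bigr do rewrite mulr_sumr.
  rewrite exchange_big /=; apply: eq_bigr => i _.
  rewrite {1}cE summxE mulr_suml.
  by apply: eq_bigr => k _; rewrite mxE mulrA.
by apply: big1 => k _; rewrite orth ?mulr0 ?mem_nth.
Qed.

Lemma span_orthogonal (R : fieldType) (n : nat) (s : seq 'rV[R]_n)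
    (c : 'rV[R]_n) :
  (forall l : 'rV[R]_n, (forall d, d \in s -> \sum_i d 0 i * l 0 i = 0) ->
     \sum_i c 0 i * l 0 i = 0) ->
  c \in <<s>>%VS.
Proof.
move=> orth; pose M : 'M[R]_(size s, n) := \matrix_(k < size s) s`_k.
(* The columns of [cokermx M] are orthogonal to [s], hence to [c]; being killed by the cokernel
   means lying in the row space. *)
have /submxP[D ->] : (c <= M)%MS.
  rewrite submxE; apply/eqP/rowP => j.
  have colE (d : 'rV_n) : \sum_i d 0 i * (col j (cokermx M))^T 0 i =
      (d *m cokermx M) 0 j by rewrite mxE; apply: eq_bigr => i _; rewrite !mxE.
  rewrite -colE [RHS]mxE; apply: orth => d /(nthP 0)[k ks <-].
  have -> : s`_k = row (Ordinal ks) M by rewrite rowK.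
  by rewrite colE -row_mul mulmx_coker !mxE.
rewrite mulmx_sum_row; apply: memv_suml => k _; apply: memvZ; rewrite rowK.
exact/memv_span/mem_nth.
Qed.

(** * Rotated velocities and the normals of lines *)

(** Pairing of the normal of [l] with the quarter turn (w_1, - w_0) of [w]. *)
Definition twist (R : realType) (l : 'rV[R]_3) (w : 'rV[R]_2) : R :=
  l 0 0 * w 0 1 - l 0 1 * w 0 0.

(** Determinant of the two normals; it vanishes when the lines are parallel. *)
Definition bracket (R : realType) (l m : 'rV[R]_3) : R :=
  l 0 0 * m 0 1 - l 0 1 * m 0 0.

Lemma dot3E (R : realType) (l x : 'rV[R]_3) :
  dot l x = l 0 0 * x 0 0 + l 0 1 * x 0 1 + l 0 ord_max * x 0 ord_max.
Proof. exact: sum_ord3. Qed.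

Lemma dot2E (R : realType) (x y : 'rV[R]_2) :
  dot x y = x 0 0 * y 0 0 + x 0 1 * y 0 1.
Proof. exact: sum_ord2. Qed.

Lemma bracket_neq0 (R : realType) (n : nat) (alpha : 'I_n -> 'rV[R]_3) :
  no_meet_at_infinity alpha ->
  forall i j, i != j -> bracket (alpha i) (alpha j) != 0.
Proof.
move=> hinfty i j ij; apply/eqP => b0; apply: (hinfty i j ij).
pose x (u v : R) : 'rV[R]_3 := \row_k (if k == 0 then u else if k == 1 then v else 0).
have xi (l : 'rV[R]_3) u v : dot l (x u v) = l 0 0 * u + l 0 1 * v.
  by rewrite dot3E !mxE /= mulr0 addr0.
have al0 u v : dot (alpha0 R) (x u v) = 0.
  by rewrite xi !mxE /= !mul0r addr0.
have x0 u v : (u != 0) || (v != 0) -> x u v != 0.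
  rewrite -negb_and; apply: contra => /eqP /rowP x0.
  by have := x0 0; have := x0 1; rewrite !mxE /= => -> ->; rewrite !eqxx.
(* The common point at infinity is the direction of either line whose normal is nonzero; if both
   normals vanish, every point at infinity is common. *)
have [i0|i0] := boolP ((- alpha i 0 1 != 0) || (alpha i 0 0 != 0)).
  exists (x (- alpha i 0 1) (alpha i 0 0)); rewrite x0 // al0 !xi.
  by split=> //; [ring | rewrite -[RHS]b0 /bracket; ring].
have [j0|j0] := boolP ((- alpha j 0 1 != 0) || (alpha j 0 0 != 0)).
  exists (x (- alpha j 0 1) (alpha j 0 0)); rewrite x0 // al0 !xi.
  split=> //; last by ring.
  by rewrite -[RHS]oppr0 -[X in _ = - X]b0 /bracket; ring.
exists (x 1 0); rewrite x0 ?oner_neq0 // al0 !xi.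
move: i0 j0; rewrite !negb_or !negbK => /andP[_ /eqP ->] /andP[_ /eqP ->].
by split=> //; rewrite mul0r mulr0 addr0.
Qed.

Lemma twist_cramer (R : realType) (l m : 'rV[R]_3) (x y : R) :
  bracket l m != 0 -> exists w, twist l w = x /\ twist m w = y.
Proof.
rewrite /bracket /twist => b0.
exists (\row_k if k == 0 then (x * m 0 0 - y * l 0 0) / bracket l m
               else (x * m 0 1 - y * l 0 1) / bracket l m).
by rewrite !mxE /bracket /=; split; field.
Qed.

Lemma twist_eq0 (R : realType) (l m : 'rV[R]_3) (w : 'rV[R]_2) :
  bracket l m != 0 -> twist l w = 0 -> twist m w = 0 -> w = 0.
Proof.
rewrite /bracket /twist => b0 hl hm.
apply: plane_eq0; apply: (mulfI b0); rewrite mulr0.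
- have -> : 0 = m 0 0 * (l 0 0 * w 0 1 - l 0 1 * w 0 0)
              - l 0 0 * (m 0 0 * w 0 1 - m 0 1 * w 0 0).
    by rewrite hl hm !mulr0 subr0.
  by ring.
- have -> : 0 = m 0 1 * (l 0 0 * w 0 1 - l 0 1 * w 0 0)
              - l 0 1 * (m 0 0 * w 0 1 - m 0 1 * w 0 0).
    by rewrite hl hm !mulr0 subr0.
  by ring.
Qed.

Lemma twistB (R : realType) (l : 'rV[R]_3) (w z : 'rV[R]_2) :
  twist l (w - z) = twist l w - twist l z.
Proof. by rewrite /twist !mxE; ring. Qed.

(* A vector is orthogonal to the direction of a line exactly when, rotated by a
   quarter turn, it is orthogonal to the normal of the line. *)
Lemma dot_twist (R : realType) (l : 'rV[R]_3) (d w : 'rV[R]_2) :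
  (l 0 0 != 0) || (l 0 1 != 0) -> d != 0 ->
  l 0 0 * d 0 0 + l 0 1 * d 0 1 = 0 -> (dot d w = 0 <-> twist l w = 0).
Proof.
move=> l0 d0 ld; rewrite dot2E /twist.
have d0' : (d 0 0 != 0) || (d 0 1 != 0).
  by rewrite -negb_and; apply: contra d0 => /andP[/eqP ? /eqP ?]; apply/eqP/plane_eq0.
split=> h.
(* As [d] is nonzero, it suffices to kill the twist times each coordinate of [d]; the converse uses
   the normal in the same way. *)
- have e0 : d 0 0 * (l 0 0 * w 0 1 - l 0 1 * w 0 0) = 0.
    have := congr1 ( *%R (l 0 1)) h; have := congr1 ( *%R (w 0 1)) ld; lra.
  have e1 : d 0 1 * (l 0 0 * w 0 1 - l 0 1 * w 0 0) = 0.
    have := congr1 ( *%R (l 0 0)) h; have := congr1 ( *%R (w 0 0)) ld; lra.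
  move/eqP: e0; move/eqP: e1; rewrite !mulf_eq0.
  by case/orP: d0' => /negbTE ->; [move=> _ /eqP | move=> /eqP].
- have e0 : l 0 0 * (d 0 0 * w 0 0 + d 0 1 * w 0 1) = 0.
    have := congr1 ( *%R (d 0 1)) h; have := congr1 ( *%R (w 0 0)) ld; lra.
  have e1 : l 0 1 * (d 0 0 * w 0 0 + d 0 1 * w 0 1) = 0.
    have := congr1 ( *%R (d 0 0)) h; have := congr1 ( *%R (w 0 1)) ld; lra.
  move/eqP: e0; move/eqP: e1; rewrite !mulf_eq0.
  by case/orP: l0 => /negbTE ->; [move=> _ /eqP | move=> /eqP].
Qed.

Lemma card_set3 (T : finType) (x y z : T) :
  x != y -> y != z -> z != x -> #|[set x; y; z]| = 3%N.
Proof.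
move=> xy yz zx; rewrite -setUA !cardsU1 cards1 !inE.
by rewrite (negbTE xy) eq_sym (negbTE zx) (negbTE yz).
Qed.

(** * Infinitesimal motions as concurrent shifts of the lines *)

Section Framework.

Variables (R : realType) (U : finType) (n : nat) (e : 'I_n -> {set U}).
Variables (p : U -> 'rV[R]_2) (alpha : 'I_n -> 'rV[R]_3).
Hypothesis simple : simple_graph e.
Hypothesis degree2 : forall u, (2 <= degree e u)%N.
Hypothesis forms : edge_forms e p alpha.
Hypothesis generic : is_generic_matroid R e (linear_matroid alpha).
Hypothesis no_meet : no_meet_at_infinity alpha.

Let br i j : R := bracket (alpha i) (alpha j).

Lemma form_at_vertex i a : a \in e i ->
  alpha i 0 ord_max = - (alpha i 0 0 * p a 0 0 + alpha i 0 1 * p a 0 1).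
Proof.
case: (forms i) => _ _ van /van; rewrite dot_affine => h.
by apply/eqP; rewrite -addr_eq0 addrC h.
Qed.

Lemma normal_neq0 i : (alpha i 0 0 != 0) || (alpha i 0 1 != 0).
Proof.
have [_ l0 _] := forms i; rewrite -negb_and; apply: contra l0.
move=> /andP[/eqP l0 /eqP l1]; apply/eqP/form_eq0 => //.
have /eqP/cards2P[a [b [_ E]]] := simple.2 i.
have ai : a \in e i by rewrite E set21.
by rewrite (form_at_vertex ai) l0 l1 !mul0r addr0 oppr0.
Qed.

Lemma two_edges a : exists i j, [/\ i != j, a \in e i & a \in e j].
Proof.
have /card_gt1P[i [j [ai aj ij]]] := degree2 a.
by move: ai aj; rewrite !inE => ai aj; exists i, j.
Qed.

(* [l] is the vector lambda of line shifts determined by the velocities [v]. *)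
Definition slides (v : {ffun U -> 'rV[R]_2}) (l : 'rV[R]_n) : Prop :=
  forall i a, a \in e i -> twist (alpha i) (v a) = l 0 i.

(* Averaging over the two endpoints avoids choosing one of them. *)
Definition shift (v : {ffun U -> 'rV[R]_2}) : 'rV[R]_n :=
  \row_i (2^-1 * \sum_(a in e i) twist (alpha i) (v a)).

Lemma slides_shift v l : slides v l -> l = shift v.
Proof.
move=> vl; apply/rowP => i; rewrite mxE.
rewrite (eq_bigr (fun=> l 0 i)) => [|a /vl //].
by rewrite sumr_const simple.2; field.
Qed.

(** The difference of the endpoints lies along the line, so by [dot_twist] the edge condition
    equates the two twists, and both then equal their average. *)
Lemma motionE v : infinitesimal_motion e p v <-> slides v (shift v).
Proof.
have edge i a b : a \in e i -> b \in e i -> a != b ->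
    dot (p a - p b) (v a - v b) = 0 <->
    twist (alpha i) (v a) - twist (alpha i) (v b) = 0.
  move=> ai bi ab; rewrite -twistB; apply: dot_twist (normal_neq0 i) _ _.
    have [inj _ _] := forms i.
    by rewrite subr_eq0; apply: contra ab => /eqP /inj ->.
  rewrite !mxE; have := form_at_vertex ai; have := form_at_vertex bi; lra.
split=> [motion i a ai|vl i a b ai bi].
- rewrite mxE (eq_bigr (fun=> twist (alpha i) (v a))) => [|b bi].
    by rewrite sumr_const simple.2; field.
  have [-> //|ba] := eqVneq b a.
  by apply/eqP; rewrite -subr_eq0; apply/eqP/(edge i) => //; apply: (motion i).
- have [->|ab] := eqVneq a b.
    by rewrite subrr dot2E !mxE !mul0r addr0.
  by apply/(edge i) => //; rewrite !vl // subrr.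
Qed.

Lemma slides_motion v l : slides v l -> infinitesimal_motion e p v.
Proof. by move=> vl; apply/motionE; rewrite -(slides_shift vl). Qed.

(** Injectivity of the passage from velocities to shifts: two nonparallel lines meet at each
    vertex. *)
Lemma slides0 v : slides v 0 -> v = 0.
Proof.
move=> v0; apply/ffunP => a; rewrite ffunE.
have [i [j [ij ai aj]]] := two_edges a.
by apply: (twist_eq0 (bracket_neq0 no_meet ij)); rewrite (v0 _ a) // mxE.
Qed.

(** The expression is the determinant of the three shifted forms: at a common vertex the constant
    terms of [alpha] are combinations of the normals and drop out. *)
Definition concurrent (l : 'rV[R]_n) : Prop :=
  forall a i j k, a \in e i -> a \in e j -> a \in e k ->
    i != j -> j != k -> k != i ->
    br j k * l 0 i + br k i * l 0 j + br i j * l 0 k = 0.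

(** Two lines through a vertex fix its velocity by Cramer's rule, and concurrency makes it fit every
    other line there. *)
Lemma concurrent_slides l : concurrent l -> exists v, slides v l.
Proof.
move=> conc.
have /fin_all_exists[v vl] (a : U) :
    exists w, forall i, a \in e i -> twist (alpha i) w = l 0 i.
  have [i [j [ij ai aj]]] := two_edges a.
  have b0 := bracket_neq0 no_meet ij.
  have [w [wi wj]] := twist_cramer (l 0 i) (l 0 j) b0.
  exists w => k ak.
  have [->//|ki] := eqVneq k i; have [->//|kj] := eqVneq k j.
  have := conc a i j k ai aj ak ij; rewrite eq_sym => /(_ kj ki).
  rewrite -wi -wj => h; apply: (mulfI b0).
  move: h; rewrite /br /bracket /twist; lra.
by exists (finfun v) => i a ai; rewrite ffunE vl.
Qed.

(** * Relations with at most three nonzero entries *)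

Lemma relation_coord c (m : 'I_3) : linear_relation alpha c ->
  \sum_i c 0 i * alpha i 0 m = 0.
Proof.
move=> rel; have := congr1 (fun l : 'rV_3 => l 0 m) rel.
rewrite summxE mxE => h; rewrite -[RHS]h.
by apply: eq_bigr => i _; rewrite mxE.
Qed.

Definition triple_relation i j k : 'rV[R]_n :=
  br j k *: delta_mx 0 i + br k i *: delta_mx 0 j + br i j *: delta_mx 0 k.

Lemma triple_relationE i j k (F : 'I_n -> R) :
  \sum_l triple_relation i j k 0 l * F l =
  br j k * F i + br k i * F j + br i j * F k.
Proof.
have pick m : \sum_l (delta_mx 0 m : 'rV[R]_n) 0 l * F l = F m.
  rewrite (bigD1 m) //= mxE !eqxx mul1r big1 ?addr0 // => l lm.
  by rewrite mxE (negbTE lm) andbF mul0r.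
rewrite -(pick i) -(pick j) -(pick k) !mulr_sumr -!big_split /=.
by apply: eq_bigr => l _; rewrite !mxE; ring.
Qed.

(** The brackets give the Cramer relation between three plane normals; at a common vertex the
    constant terms are the same combination of the normals and satisfy it too. *)
Lemma triple_relation_linear a i j k :
  a \in e i -> a \in e j -> a \in e k ->
  linear_relation alpha (triple_relation i j k).
Proof.
move=> ai aj ak; apply/rowP => m; rewrite summxE [RHS]mxE.
under eq_bigr do rewrite mxE.
rewrite triple_relationE; have := form_at_vertex ai; have := form_at_vertex aj.
have := form_at_vertex ak => hk hj hi; rewrite /br /bracket.
case: m => -[|[|[|//]]] h.
- by rewrite (_ : Ordinal h = 0) ?[LHS]/=; [ring | apply: val_inj].
- by rewrite (_ : Ordinal h = 1) ?[LHS]/=; [ring | apply: val_inj].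
- by rewrite (_ : Ordinal h = ord_max) ?hi ?hj ?hk; [ring | apply: val_inj].
Qed.

Lemma triple_relation_support i j k : i != j -> j != k -> k != i ->
  [set l | triple_relation i j k 0 l != 0] = [set i; j; k].
Proof.
move=> ij jk ki; apply/setP => l; rewrite !inE !mxE eqxx /=.
have /negbTE ji : j != i by rewrite eq_sym.
have /negbTE kj : k != j by rewrite eq_sym.
have /negbTE ik : i != k by rewrite eq_sym.
have [->|] := eqVneq l i; last have [->|] := eqVneq l j;
  last have [->|] := eqVneq l k.
- by rewrite (negbTE ij) ik !mulr0 !addr0 mulr1 bracket_neq0.
- by rewrite (negbTE jk) !mulr0 addr0 add0r mulr1 bracket_neq0.
- by rewrite !mulr0 !add0r mulr1 bracket_neq0.
- by rewrite !mulr0 !addr0 eqxx.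
Qed.

(** One nonzero entry would force a zero normal and two would force parallel lines. With three, the
    edges are dependent, so by [generic_triple] they share a vertex. *)
Lemma relation_vertex (c : 'rV[R]_n) : c != 0 -> linear_relation alpha c ->
  (#|[set i | c 0 i != 0]%R| <= 3)%N ->
  exists a, forall i, c 0 i != 0 -> a \in e i.
Proof.
move=> cn0 rel card3.
have [/existsP[i ci]|] := boolP [exists i, c 0 i != 0]; last first.
  rewrite negb_exists => /forallP c0; case/eqP: cn0; apply/rowP => i.
  by rewrite mxE; apply/eqP/negPn/c0.
have [/existsP[j /andP[ji cj]]|] := boolP [exists j, (j != i) && (c 0 j != 0)];
  last first.
  rewrite negb_exists => /forallP c0.
  have cl l : l != i -> c 0 l = 0.
    by move=> li; have := c0 l; rewrite li negbK => /eqP.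
  have co m : alpha i 0 m = 0.
    apply: (mulfI ci); rewrite mulr0 -[RHS](relation_coord m rel).
    rewrite (bigD1 i) //= big1 ?addr0 // => l /cl ->.
    by rewrite mul0r.
  by have := normal_neq0 i; rewrite !co eqxx.
have [/existsP[k /and3P[ki kj ck]]|] :=
    boolP [exists k, [&& k != i, k != j & c 0 k != 0]]; last first.
  rewrite negb_exists => /forallP c0.
  have cl l : l != i -> l != j -> c 0 l = 0.
    by move=> li lj; have := c0 l; rewrite li lj negbK => /eqP.
  have co m : c 0 i * alpha i 0 m + c 0 j * alpha j 0 m = 0.
    rewrite -[RHS](relation_coord m rel) (bigD1 i) //= (bigD1 j) //=.
    rewrite big1 ?addr0 // => l /andP[li lj].
    by rewrite cl ?mul0r.
  have b0 : br i j != 0 by apply: bracket_neq0 => //; rewrite eq_sym.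
  case/eqP: ci; apply: (mulIf b0); rewrite mul0r /br /bracket.
  have := congr1 ( *%R (alpha j 0 1)) (co 0).
  have := congr1 ( *%R (alpha j 0 0)) (co 1); lra.
have ij : i != j by rewrite eq_sym.
have jk : j != k by rewrite eq_sym.
have card_ijk := card_set3 ij jk ki.
have supp : [set l | c 0 l != 0] = [set i; j; k].
  apply/esym/eqP; rewrite eqEcard card_ijk card3 andbT.
  by apply/subsetP => l; rewrite !inE => /orP[/orP[]|] /eqP ->.
have [/existsP[a /and3P[ai aj ak]]|noa] :=
    boolP [exists a, [&& a \in e i, a \in e j & a \in e k]].
  exists a => l cl; have : l \in [set i; j; k] by rewrite -supp inE.
  by rewrite !inE => /orP[/orP[]|] /eqP ->.
have /linear_matroidP ind : [set i; j; k] \in linear_matroid alpha.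
  apply: (generic_triple simple generic ij jk ki) => u [ui uj uk].
  by case/negP: noa; apply/existsP; exists u; rewrite ui uj uk.
case/eqP: cn0; apply: ind rel => l; rewrite -supp inE negbK.
by move/eqP.
Qed.

(** On the support of [c] all shifts come from the velocity of one vertex, so the sum is a
    combination of the coordinates of the relation. *)
Lemma slides_orthogonal v l (c : 'rV[R]_n) : slides v l ->
  linear_relation alpha c -> (#|[set i | c 0 i != 0]%R| <= 3)%N ->
  \sum_i c 0 i * l 0 i = 0.
Proof.
move=> vl rel card3; have [->|cn0] := eqVneq c 0.
  by apply: big1 => i _; rewrite mxE mul0r.
have [a ac] := relation_vertex cn0 rel card3.
have -> : \sum_i c 0 i * l 0 i = v a 0 1 * (\sum_i c 0 i * alpha i 0 0)
                               - v a 0 0 * (\sum_i c 0 i * alpha i 0 1).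
  rewrite !mulr_sumr -sumrB; apply: eq_bigr => i _.
  have [->|/ac ai] := eqVneq (c 0 i) 0; first by rewrite !mul0r !mulr0 subrr.
  by rewrite -(vl i a ai) /twist; ring.
by rewrite !relation_coord // !mulr0 subrr.
Qed.

(** * Weak perspective representations *)

Lemma perspective_relation (c l : 'rV[R]_n) :
  \sum_i c 0 i *: perspective alpha l i =
  \sum_i c 0 i *: alpha i + (\sum_i c 0 i * l 0 i) *: alpha0 R.
Proof.
rewrite scaler_suml -big_split; apply: eq_bigr => i _ /=.
by rewrite scalerDr scalerA.
Qed.

(** A set independent after the shift has at most three elements, so every relation of [alpha]
    supported on it is orthogonal to [l] and survives the shift; hence it is zero. *)
Lemma slides_weak_perspective v l : slides v l -> weak_perspective alpha l.
Proof.
move=> vl r S; apply: contra; rewrite !inE => /andP[Sfree _].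
have S3 : (#|S| <= 3)%N.
  move: (Sfree); rewrite /free size_image => /eqP <-.
  by rewrite (leq_trans (dimvS (subvf _))) // dimvf.
have Sind : S \in linear_matroid alpha.
  apply/linear_matroidP => c c0 rel.
  have /linear_matroidP : S \in linear_matroid (perspective alpha l) by rewrite inE.
  apply=> //; rewrite /linear_relation perspective_relation rel add0r.
  rewrite (slides_orthogonal vl) ?scale0r // (leq_trans _ S3) // subset_leq_card //.
  by apply/subsetP => i; rewrite inE; apply: contraR => /c0 ->.
have := Sind; rewrite inE => -> /=.
exact: (@leq_bigmax_cond _ (mem (linear_matroid alpha)) (fun S => #|S|) S Sind).
Qed.

(** An edge together with a further edge at each of its endpoints has no common vertex. The bound
    ensures that truncation keeps independent triples. *)
Lemma rank3 (a : U) : (3 <= matroid_rank (linear_matroid alpha))%N.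
Proof.
have [i [_ [_ ai _]]] := two_edges a.
have pick2 u : exists2 j, j != i & u \in e j.
  have [j [k [jk uj uk]]] := two_edges u.
  have [ji|ji] := eqVneq j i; last by exists j.
  by exists k => //; rewrite -ji eq_sym.
have [b ba Eab] := pair_other (simple.2 i) ai.
have [j ji aj] := pick2 a; have [k ki bk] := pick2 b.
have eij l : a \in e l -> b \in e l -> l = i.
  move=> al bl; apply: simple.1; apply/esym/eqP.
  rewrite eqEcard !simple.2 leqnn andbT Eab.
  by apply/subsetP => u; rewrite !inE => /orP[] /eqP ->.
have jk : j != k.
  by apply: contra ji => /eqP jk; rewrite (eij j) // jk.
have ij : i != j by rewrite eq_sym.
have ind : [set i; j; k] \in linear_matroid alpha.
  apply: (generic_triple simple generic ij jk ki) => u [ui uj uk].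
  move: ui; rewrite Eab !inE => /orP[] /eqP Eu; subst u.
    by case/eqP: ki; apply: eij.
  by case/eqP: ji; apply: eij.
have := @leq_bigmax_cond _ (mem (linear_matroid alpha)) (fun S => #|S|) _ ind.
by rewrite card_set3.
Qed.

Lemma weak_perspective_concurrent l : weak_perspective alpha l -> concurrent l.
Proof.
move=> weak a i j k ai aj ak ij jk ki; apply/eqP/negPn/negP => T0.
have kj : k != j by rewrite eq_sym.
have dep : [set i; j; k] \notin linear_matroid alpha.
  apply/negP => /linear_matroidP /(_ (triple_relation i j k)) ind.
  have /rowP/(_ i) : triple_relation i j k = 0.
    apply: ind (triple_relation_linear ai aj ak) => m.
    by rewrite -(triple_relation_support ij jk ki) inE negbK => /eqP.
  apply/eqP; rewrite [X in _ != X]mxE.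
  by have /setP/(_ i) := triple_relation_support ij jk ki; rewrite !inE eqxx.
have /negP := weak [set i; j; k] (contra (fun h => proj1 (setIdP h)) dep).
apply; rewrite inE (leq_trans _ (rank3 a)) ?andbT; last first.
  by rewrite card_set3.
apply/linear_matroidP => c c0 rel.
have co m : c 0 i * perspective alpha l i 0 m + c 0 j * perspective alpha l j 0 m
    + c 0 k * perspective alpha l k 0 m = 0.
  have := congr1 (fun f : 'rV_3 => f 0 m) rel.
  rewrite (sum_support3 ij jk ki) => [|q /c0 -> //]; last by rewrite scale0r.
  by rewrite !mxE.
have := co 0; have := co 1; have := co ord_max; rewrite !mxE /=.
rewrite !mulr0 !addr0 !mulr1 => co2 co1 co0.
(* Evaluate the relation at the vertex, where each shifted form takes the value of its shift. *)
have L : c 0 i * l 0 i + c 0 j * l 0 j + c 0 k * l 0 k = 0.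
  have hi := form_at_vertex ai; have hj := form_at_vertex aj.
  have hk := form_at_vertex ak.
  have e0 := congr1 ( *%R (p a 0 0)) co0; have e1 := congr1 ( *%R (p a 0 1)) co1.
  by move: co2 e0 e1; rewrite hi hj hk; lra.
(* The coefficients of a relation between the three normals are proportional
   to the brackets. *)
have Lbr x : x * (c 0 i * l 0 i + c 0 j * l 0 j + c 0 k * l 0 k) = 0.
  by rewrite L mulr0.
have comb x y : x * (c 0 i * alpha i 0 0 + c 0 j * alpha j 0 0 + c 0 k * alpha k 0 0)
   + y * (c 0 i * alpha i 0 1 + c 0 j * alpha j 0 1 + c 0 k * alpha k 0 1) = 0.
  by rewrite co0 co1 !mulr0 addr0.
have ci : c 0 i = 0.
  apply: (mulIf T0); rewrite mul0r -[RHS](Lbr (br j k)) /br /bracket.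
  have := comb (alpha k 0 1 * l 0 j) (- alpha k 0 0 * l 0 j).
  have := comb (alpha j 0 1 * l 0 k) (- alpha j 0 0 * l 0 k); lra.
have cj : c 0 j = 0.
  apply: (mulIf T0); rewrite mul0r -[RHS](Lbr (br k i)) /br /bracket.
  have := comb (alpha k 0 1 * l 0 i) (- alpha k 0 0 * l 0 i).
  have := comb (alpha i 0 1 * l 0 k) (- alpha i 0 0 * l 0 k); lra.
have ck : c 0 k = 0.
  apply: (mulIf T0); rewrite mul0r -[RHS](Lbr (br i j)) /br /bracket.
  have := comb (alpha i 0 1 * l 0 j) (- alpha i 0 0 * l 0 j).
  have := comb (alpha j 0 1 * l 0 i) (- alpha j 0 0 * l 0 i); lra.
apply/rowP => q; rewrite mxE; have [|/c0//] := boolP (q \in [set i; j; k]).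
by rewrite !inE => /orP[/orP[]|] /eqP ->.
Qed.


(** * Formality and infinitesimal rigidity *)

(** The relations are the orthogonal complement of the three coordinate vectors of [alpha], so the
    double complement applies; [x] collects the coefficients. *)
Lemma relation_orthogonal (l : 'rV[R]_n) :
  (forall c, linear_relation alpha c -> \sum_i c 0 i * l 0 i = 0) ->
  exists x, forall i, l 0 i = dot (alpha i) x.
Proof.
move=> orth.
pose X := [tuple (\row_i alpha i 0 m : 'rV[R]_n) | m < 3].
have lX : l \in <<X>>%VS.
  apply: span_orthogonal => c cX; under eq_bigr do rewrite mulrC.
  apply: orth; apply/rowP => m; rewrite summxE [RHS]mxE.
  rewrite -[RHS](cX (tnth X m)) ?mem_tnth // tnth_mktuple.
  by apply: eq_bigr => i _; rewrite !mxE mulrC.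
exists (\row_m coord X m l) => i; rewrite {1}(coord_span lX) summxE.
by apply: eq_bigr => m _; rewrite mxE nth_mktuple !mxE mulrC.
Qed.

Lemma trivial_motion_slides v l : slides v l ->
  (trivial_motion p v <-> exists x, forall i, l 0 i = dot (alpha i) x).
Proof.
move=> vl; split=> [[A [t [skew vA]]]|[x lx]].
(* The translation is turned by a quarter turn, and the rotation speed multiplies the constant term
   of each form; the converse inverts this assignment. *)
- exists (\row_m if m == 0 then t 0 1 else if m == 1 then - t 0 0 else - A 0 1).
  move=> i; have /eqP/cards2P[a [b [_ E]]] := simple.2 i.
  have ai : a \in e i by rewrite E set21.
  have sk r s : A r s = - A s r.
    by have /matrixP/(_ s r) := skew; rewrite !mxE.
  have A0 r : A r r = 0 by have := sk r r; lra.
  rewrite -(vl i a ai) vA dot3E /twist !mxE /= !sum_ord2 !A0 (sk 1 0).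
  by rewrite (form_at_vertex ai); ring.
- pose A : 'M[R]_2 := \matrix_(r, s)
    if r == s then 0 else if r == 0 then - x 0 ord_max else x 0 ord_max.
  pose t : 'rV[R]_2 := \row_m if m == 0 then - x 0 1 else x 0 0.
  exists A, t; split=> [|a].
    apply/matrixP => r s; rewrite !mxE eq_sym.
    case: eqVneq => [_|]; first by rewrite oppr0.
    by case: r => -[|[|//]] ? /=; case: s => -[|[|//]] ? //=; rewrite ?opprK.
  have [i [j [ij ai aj]]] := two_edges a.
  apply/eqP; rewrite -subr_eq0; apply/eqP.
  apply: (twist_eq0 (bracket_neq0 no_meet ij)); rewrite twistB (vl _ a) // lx dot3E.
  - by rewrite /twist !mxE !sum_ord2 !mxE /= (form_at_vertex ai); ring.
  - by rewrite /twist !mxE !sum_ord2 !mxE /= (form_at_vertex aj); ring.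
Qed.

Lemma formal_rigid : formal alpha <-> infinitesimally_rigid e p.
Proof.
split=> [formal v motion|rigid c rel].
- have vl := (motionE v).1 motion.
  apply/(trivial_motion_slides vl)/relation_orthogonal => c /formal[s [s3 cs]].
  apply: orthogonal_span cs _ => d /s3[rel d3].
  by apply: slides_orthogonal vl rel _; rewrite d3.
(* The generators are the triple relations at the vertices. A vector orthogonal to them is
   concurrent, so it comes from a motion, which is trivial by rigidity. *)
pose admissible (t : 'I_n * 'I_n * 'I_n) :=
  [&& t.1.1 != t.1.2, t.1.2 != t.2, t.2 != t.1.1 &
      [exists a, [&& a \in e t.1.1, a \in e t.1.2 & a \in e t.2]]].
pose s := [seq triple_relation t.1.1 t.1.2 t.2 | t <- enum admissible].
exists s; split.
  move=> d /mapP[[[i j] k]]; rewrite mem_enum.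
  case/and4P=> /= ij jk ki /existsP[a /and3P[ai aj ak]] ->; split.
    exact: triple_relation_linear ai aj ak.
  by rewrite triple_relation_support // card_set3.
apply: span_orthogonal => l ls.
have [a i j k ai aj ak ij jk ki|v vl] := @concurrent_slides l.
  rewrite -(triple_relationE i j k (fun m => l 0 m)); apply: ls.
  apply/mapP; exists (i, j, k) => //; rewrite mem_enum; apply/and4P; split=> //.
  by apply/existsP; exists a; rewrite /= ai aj ak.
have [x lx] := (trivial_motion_slides vl).1 (rigid v (slides_motion vl)).
have -> : \sum_i c 0 i * l 0 i = \sum_m (\sum_i c 0 i * alpha i 0 m) * x 0 m.
  under [RHS]eq_bigr do rewrite mulr_suml.
  rewrite exchange_big /=; apply: eq_bigr => i _.
  by rewrite lx /dot mulr_sumr; apply: eq_bigr => m _; rewrite mulrA.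
by apply: big1 => m _; rewrite relation_coord ?mul0r.
Qed.

(** * The linear isomorphism *)

Fact shift_is_linear : linear shift.
Proof.
move=> a u v; apply/rowP => i; rewrite !mxE mulrCA -mulrDr; congr (_ * _).
rewrite mulr_sumr -big_split; apply: eq_bigr => b _.
by rewrite !ffunE /twist !mxE /=; ring.
Qed.
HB.instance Definition _ := GRing.isLinear.Build R _ _ _ shift shift_is_linear.

(** A linear map whose kernel is the space of infinitesimal motions, which presents that space as a
    [vspace]. *)
Definition slide_defect (v : {ffun U -> 'rV[R]_2}) : 'M[R]_(n, #|U|) :=
  \matrix_(i, k) if enum_val k \in e i
                 then twist (alpha i) (v (enum_val k)) - shift v 0 i else 0.

Fact slide_defect_is_linear : linear slide_defect.
Proof.
move=> a u v; apply/matrixP => i k; rewrite mxE linearP !mxE.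
case: ifP => _; last by rewrite mulr0 addr0.
by rewrite !ffunE /twist !mxE /=; ring.
Qed.
HB.instance Definition _ :=
  GRing.isLinear.Build R _ _ _ slide_defect slide_defect_is_linear.

Lemma slide_defect_eq0 v : slide_defect v = 0 <-> slides v (shift v).
Proof.
split=> [/matrixP v0 i a ai|vl].
  have := v0 i (enum_rank a); rewrite !mxE enum_rankK ai => /eqP.
  by rewrite subr_eq0 => /eqP.
apply/matrixP => i k; rewrite !mxE; case: ifP => // ai.
by rewrite (vl i) // mxE subrr.
Qed.

(** The isomorphism is [shift] restricted to the motions; its image is the space of weak perspective
    representations. *)
Lemma motions_isomorphic :
  isomorphic_spaces (infinitesimal_motion e p) (weak_perspective alpha).
Proof.
pose A := lker (linfun slide_defect); pose f := linfun shift.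
have memA v : v \in A <-> infinitesimal_motion e p v.
  rewrite memv_ker lfunE /=; split=> [/eqP/slide_defect_eq0/motionE //|].
  by move/motionE/slide_defect_eq0/eqP.
have injA v : v \in A -> shift v = 0 -> v = 0.
  by move=> /memA/motionE vl v0; apply: slides0; rewrite -v0.
have injf : {in A &, injective shift}.
  move=> u v uA vA uv; apply/eqP; rewrite -subr_eq0; apply/eqP/injA.
    exact: rpredB.
  by rewrite linearB /= uv subrr.
have memB (w : 'rV[R]_n) : w \in (f @: A)%VS <-> weak_perspective alpha w.
  split=> [/memv_imgP[v /memA/motionE vA ->]|].
    by rewrite lfunE; apply: slides_weak_perspective vA.
  move/weak_perspective_concurrent/concurrent_slides => [v vw].
  rewrite (slides_shift vw) -[shift v](lfunE shift).
  by apply/memv_img/memA/slides_motion/vw.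
exists A, (f @: A)%VS; split=> //.
pose g : {linear subvs_of A -> subvs_of (f @: A)%VS} :=
  (vsproj (f @: A)%VS \o f \o vsval)%FUN.
exists g.
have gE u : vsval (g u) = shift (vsval u).
  by rewrite /g /= vsprojK ?memv_img ?subvsP // lfunE.
have ginj : injective g.
  move=> u v uv; apply/val_inj/injf; rewrite ?subvsP //.
  by rewrite -[LHS]gE -[RHS]gE uv.
have gsurj w : exists u, g u == w.
  have /memv_imgP[v vA wv] := subvsP w.
  exists (vsproj A v); apply/eqP/val_inj.
  by rewrite [LHS]gE vsprojK // [RHS]wv lfunE.
(* [bijective] asks for an inverse function, here a chosen preimage. *)
exists (fun w => xchoose (gsurj w)) => [u|w]; last exact: eqP (xchooseP (gsurj w)).
exact: ginj (eqP (xchooseP (gsurj (g u)))).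
Qed.

End Framework.

Theorem proposition4p1 (R : realType) (U : finType) (n : nat)
    (e : 'I_n -> {set U}) (p : U -> 'rV[R]_2) (alpha : 'I_n -> 'rV[R]_3)
    (hG : simple_graph e)
    (hdeg : forall u : U, (2 <= degree e u)%N)
    (halpha : edge_forms e p alpha)
    (hdistinct : distinct_lines alpha)
    (hgeneric : is_generic_matroid R e (linear_matroid alpha))
    (hinfty : no_meet_at_infinity alpha) :
  isomorphic_spaces (infinitesimal_motion e p) (weak_perspective alpha) /\
  (formal alpha <-> infinitesimally_rigid e p).
Proof.
split; first exact: motions_isomorphic hG hdeg halpha hgeneric hinfty.
exact: formal_rigid hG hdeg halpha hgeneric hinfty.
Qed.
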